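(* Let $n\ge 3$. Under the action of $\mathcal{G}_n$, the map $g$ is the unique rational map of degree $n+1$ for which each $\binom{n}{2}$-hyperplane is doubly critical. That is, $g$ is a $\mathcal{G}_n$-equivariant rational map of degree $n+1$ on $\mathbf{CP}^{n-2}$ for which each $\binom{n}{2}$-hyperplane is doubly critical, and any $\mathcal{G}_n$-equivariant rational map of degree $n+1$ on $\mathbf{CP}^{n-2}$ for which each $\binom{n}{2}$-hyperplane is doubly critical equals $g$ as a map of projective space.
   Context: Use homogeneous coordinates $u=(u_1,\dots,u_{n-1})$ on $\mathbf{CP}^{n-2}$. Let $T(u_1,u_2,\dots,u_{n-1})=(-u_1,\,u_2-u_1,\,\dots,\,u_{n-1}-u_1)$. Let $\mathcal{G}_n$ be the group of transformations of $\mathbf{CP}^{n-2}$ generated by all permutations of the coordinates $u_1,\dots,u_{n-1}$ together with $T$; it is the projective image of the irreducible $(n-1)$-dimensional representation of the symmetric group $\mathcal{S}_n$ obtained from its permutation action. The $\binom{n}{2}$-hyperplanes are the hyperplanes fixed pointwise by the involutions in $\mathcal{G}_n$ that correspond to the transpositions of $\mathcal{S}_n$: the $n-1$ hyperplanes $\{u_k=0\}$ and the $\binom{n-1}{2}$ hyperplanes $\{u_k=u_\ell\}$, $k\neq\ell$. A rational map of degree $r$ is a map $h=[h_1,\dots,h_{n-1}]$ from $\mathbf{CP}^{n-2}$ to itself given by homogeneous polynomials of degree $r$ in $u$; points of indeterminacy are allowed. It is $\mathcal{G}_n$-equivariant if it commutes with every element of $\mathcal{G}_n$. With $\widetilde h=(h_1,\dots,h_{n-1})$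 the polynomial lift of $h$ to $\mathbf{C}^{n-1}$, the critical set of $h$ is given by the vanishing of the Jacobian determinant $\det D\widetilde h$, counted with multiplicity. A hyperplane is doubly critical for $h$ if it occurs in the critical set with multiplicity two, i.e. $\det D\widetilde h$ vanishes to order exactly two along it. (For degree $n+1$ the critical set has degree $(n-1)n=2\binom{n}{2}$, so if all the $\binom{n}{2}$-hyperplanes are doubly critical they make up the entire critical set.) Let $S_{n,\ell}$ be the elementary symmetric polynomial of degree $\ell$ in $u_1,\dots,u_{n-1}$, with $S_{n,0}=1$. Define $g=[g_1,\dots,g_{n-1}]$ by $$g_\ell=u_\ell^3\,G_\ell,\qquad G_\ell=\sum_{k=0}^{n-2}(-1)^k\,\frac{k+1}{k+3}\,u_\ell^k\,S_{n,n-2-k},\qquad \ell=1,\dots,n-1.$$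
   Formalization: Uniqueness is proved only among maps that send each of the binom(n,2) hyperplanes into itself with dominant restriction (hyperplane not collapsed); without this it is false, e.g. for n=3 and n=4. That g has this property is also proved. *)

(* Defs.v *)
From HB Require Import structures.
From mathcomp Require Import all_boot all_order all_algebra.
From mathcomp Require Import perm reals.
From mathcomp.real_closed Require Import complex.
From mathcomp Require Import mpoly.

Set Implicit Arguments.
Unset Strict Implicit.
Unset Printing Implicit Defensive.

Import GRing.Theory.
Local Open Scope ring_scope.

(* Homogeneous coordinates on CP^(n-2) are indexed by 'I_(ncoord n).  For
   2 <= n, ncoord n = n.-1; the successor form provides the index ord0 of the
   coordinate u_1.  All coordinate indices are 0-based. *)
Notation ncoord n := (n.-2.+1) (only parsing).

Section Defs.

Variables (C : fieldType) (n : nat).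

Let m := ncoord n.

Definition T_mx : 'M[C]_m :=
  \matrix_(i < m, j < m)
    (if i == ord0 then - (j == ord0)%:R else (j == i)%:R - (j == ord0)%:R).

(* G_n A: the projective transformation represented by the invertible matrix A,
   acting on column vectors u, belongs to the group.  The matrices below form
   the linear representation of which the group is the projective image. *)
Inductive G_n : 'M[C]_m -> Prop :=
| G_n_perm (s : 'S_m) : G_n (perm_mx s)
| G_n_T : G_n T_mx
| G_n_one : G_n 1%:M
| G_n_mul A B : G_n A -> G_n B -> G_n (A *m B)
| G_n_inv A : G_n A -> G_n (invmx A).

Inductive mirror : {mpoly C[m]} -> Prop :=
| mirror_coord (k : 'I_m) : mirror 'X_k
| mirror_diff (k l : 'I_m) : k != l -> mirror ('X_k - 'X_l).

Definition poly_lift := 'I_m -> {mpoly C[m]}.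

Definition rational_map (r : nat) (h : poly_lift) : Prop :=
  (exists i, h i != 0) /\ (forall i, h i \is r.-homog).

(* Equality of [h_1, ..., h_m] and [k_1, ..., k_m] as maps of projective
   space, for nonzero lifts. *)
Definition proj_eq (h k : poly_lift) : Prop :=
  forall i j, h i * k j = h j * k i.

Definition precomp (h : poly_lift) (A : 'M[C]_m) : poly_lift :=
  fun i => h i \mPo [tuple \sum_(k < m) A j k *: 'X_k | j < m].

Definition postcomp (A : 'M[C]_m) (h : poly_lift) : poly_lift :=
  fun i => \sum_(k < m) A i k *: h k.

Definition equivariant (h : poly_lift) : Prop :=
  forall A, G_n A -> proj_eq (precomp h A) (postcomp A h).

Definition jacobian_mx (h : poly_lift) : 'M[{mpoly C[m]}]_m :=
  \matrix_(i < m, j < m) (h i)^`M(j).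

Definition mdvd (p q : {mpoly C[m]}) : Prop := exists r, q = r * p.

Definition vanishes_to_order (a p : {mpoly C[m]}) (k : nat) : Prop :=
  mdvd (a ^+ k) p /\ ~ mdvd (a ^+ k.+1) p.

Definition doubly_critical (h : poly_lift) (a : {mpoly C[m]}) : Prop :=
  vanishes_to_order a (\det (jacobian_mx h)) 2.

Definition eval_at (p : {mpoly C[m]}) (v : 'cV[C]_m) : C :=
  p.@[fun i => v i ord0].

(* h restricts to a dominant rational self-map of the hyperplane a = 0: it
   maps the hyperplane into itself, and at some point v of the hyperplane the
   differential of the lift is injective on the hyperplane, so that the
   critical set of the restricted map is not the whole hyperplane.  Critical
   hyperplanes that are collapsed (or not preserved) by h are thus excluded. *)
Definition restricts_dominantly (h : poly_lift) (a : {mpoly C[m]}) : Prop :=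
  (forall v, eval_at a v = 0 -> eval_at a (\col_i eval_at (h i) v) = 0) /\
  (exists2 v, eval_at a v = 0 &
     forall w, eval_at a w = 0 ->
       map_mx (fun p => eval_at p v) (jacobian_mx h) *m w = 0 -> w = 0).

Definition G_coef (k : nat) : C := (-1) ^+ k * (k.+1%:R / k.+3%:R).

Definition g_map : poly_lift := fun l =>
  'X_l ^+ 3 *
  \sum_(k < n.-1) G_coef k *: ('X_l ^+ k * mesym m C (n - 2 - k)).

End Defs.

Arguments g_map : clear implicits.

(* Main.v *)
(* Up to a constant, g_l is the integral from 0 to u_l of
   Q(t) = t (t - u_1) ... (t - u_m), where m = n - 1.  A translation of t
   exchanges the root 0 with a root u_k, which gives the equivariance under T;
   and differentiating under the integral sign factors the Jacobian matrix
   through a Vandermonde matrix, so that its determinant is a nonzero constant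
   times the product of the squares of the mirrors.

   For uniqueness, a doubly critical mirror a = 0 on which h restricts
   dominantly forces a^3 to divide a(h).  The columns of Dg satisfy the
   corresponding condition with exponent 2, and det Dg has the minimal possible
   degree; so, as in Saito's criterion, Cramer's rule yields h = Dg L with L
   polynomial, of degree 1.  Comparing orders along a shows that a divides a(L)
   for every mirror a; hence L is a scalar multiple of u, and
   h is a multiple of Dg u.  The same applies to g itself. *)

Require Import Defs.
From mathcomp Require Import all_boot all_order all_algebra.
From mathcomp Require Import perm reals ring zify.
From mathcomp.real_closed Require Import complex.
From mathcomp Require Import mpoly.

Set Implicit Arguments.
Unset Strict Implicit.
Unset Printing Implicit Defensive.

Import Order.TTheory GRing.Theory Num.Theory.
Local Open Scope ring_scope.

(** * Polynomials that vanish as functions *)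

Lemma base_expansion_inj (m N : nat) (f g : 'I_m -> nat) :
    (forall i, f i < N)%N -> (forall i, g i < N)%N ->
  (\sum_i f i * N ^ i = \sum_i g i * N ^ i)%N -> f =1 g.
Proof.
elim: m f g => [f g _ _ _ []//|m IHm] f g fN gN.
have shift (h : 'I_m.+1 -> nat) : (\sum_i h i * N ^ i =
    (\sum_(i < m) h (lift ord0 i) * N ^ i) * N + h ord0)%N.
  rewrite big_ord_recl muln1 addnC big_distrl; congr (_ + _)%N.
  by apply: eq_bigr => i _; rewrite lift0 expnS mulnCA mulnC.
rewrite !shift => E.
have E0 : f ord0 = g ord0.
  by have := congr1 (modn^~ N) E; rewrite !modnMDl !modn_small.
have N_gt0 : (0 < N)%N by apply: leq_ltn_trans (fN ord0).
move/eqP: E; rewrite E0 eqn_add2r eqn_pmul2r // => /eqP E i.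
case: (unliftP ord0 i) => [j|] -> //.
exact: (IHm (fun j => f (lift ord0 j)) (fun j => g (lift ord0 j))).
Qed.

(** In characteristic 0 the natural numbers supply more distinct roots than a nonzero polynomial can
    have. *)
Lemma poly_fun_eq0 (C : numDomainType) (p : {poly C}) :
  (forall t, p.[t] = 0) -> p = 0.
Proof.
move=> p0; apply/eqP/negPn/negP => /max_poly_roots.
move=> /(_ [seq i%:R | i <- iota 0 (size p)]).
rewrite size_map size_iota ltnn => H; have // : false.
apply: H; first by apply/allP => x _; apply/eqP.
by rewrite map_inj_uniq ?iota_uniq // => i j /eqP; rewrite eqr_nat => /eqP.
Qed.

(* Kronecker substitution 'X_i |-> t^(N^i), with N above all exponents. *)
Lemma mpoly_fun_eq0 (C : numDomainType) (m : nat) (p : {mpoly C[m]}) :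
  (forall v, p.@[v] = 0) -> p = 0.
Proof.
move=> p0; pose N := msize p.
pose code (d : 'X_{1..m}) := (\sum_i d i * N ^ i)%N.
pose q : {poly C} := \sum_(d <- msupp p) p@_d *: 'X^(code d).
have q0 : q = 0.
  apply: poly_fun_eq0 => t; rewrite -[RHS](p0 (fun i => t ^+ (N ^ i))).
  rewrite horner_sum mevalE; apply: eq_bigr => d _.
  rewrite hornerZ hornerXn; congr (_ * _).
  by rewrite /code expr_sum; apply: eq_bigr => i _; rewrite -exprM mulnC.
have small (d : 'X_{1..m}) i : d \in msupp p -> (d i < N)%N.
  move=> /msize_mdeg_lt; apply: leq_ltn_trans.
  by rewrite mdegE (bigD1 i) //= leq_addr.
apply/mpolyP => d; rewrite mcoeff0.
case: (boolP (d \in msupp p)) => [dp|/memN_msupp_eq0//].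
have := congr1 (fun r : {poly C} => r`_(code d)) q0.
rewrite /q coef0 coef_sum (bigD1_seq d) ?msupp_uniq //= big1_seq.
  by rewrite addr0 coefZ coefXn eqxx mulr1.
move=> e /andP[ed ep]; rewrite coefZ coefXn.
case: eqP => [E|]; last by rewrite mulr0.
case/eqP: ed; apply/mnmP => i; apply/esym.
by apply: (@base_expansion_inj m N d e) => // j; apply: small.
Qed.

(** * Divisibility by linear forms *)

Lemma mderivXU (R : nzRingType) n (i j : 'I_n) :
  ('X_j : {mpoly R[n]})^`M(i) = (i == j)%:R.
Proof.
rewrite mderivX mnm1E eq_sym; have [->|_] := eqVneq i j;
  last by rewrite scale0r.
rewrite scale1r (_ : (U_(j) - U_(j))%MM = 0%MM) ?mpolyX0 //.
by apply/mnmP => l; rewrite mnmBE mnm0E subnn.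
Qed.

Section Divisibility.

Variables (C : fieldType) (n : nat).
Local Notation m := (ncoord n).
Implicit Types (a b p q : {mpoly C[m]}).

Lemma mdvd_refl a : mdvd a a. Proof. by exists 1; rewrite mul1r. Qed.

Lemma mdvd0 a : mdvd a 0. Proof. by exists 0; rewrite mul0r. Qed.

Lemma mdvdD a p q : mdvd a p -> mdvd a q -> mdvd a (p + q).
Proof. by move=> [r ->] [s ->]; exists (r + s); rewrite mulrDl. Qed.

Lemma mdvdMl a p q : mdvd a q -> mdvd a (p * q).
Proof. by move=> [r ->]; exists (p * r); rewrite mulrA. Qed.

Lemma mdvdMr a p q : mdvd a p -> mdvd a (p * q).
Proof. by rewrite mulrC; apply: mdvdMl. Qed.

Lemma mdvdN a p : mdvd a p -> mdvd a (- p).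
Proof. by rewrite -mulN1r; apply: mdvdMl. Qed.

Lemma mdvdB a p q : mdvd a p -> mdvd a q -> mdvd a (p - q).
Proof. by move=> ap /mdvdN; apply: mdvdD. Qed.

Lemma mdvd_addIr a p q : mdvd a q -> mdvd a (p + q) -> mdvd a p.
Proof. by move=> aq /mdvdB/(_ aq); rewrite addrK. Qed.

Lemma mdvdZ a (c : C) p : mdvd a p -> mdvd a (c *: p).
Proof. by rewrite -mul_mpolyC; apply: mdvdMl. Qed.

Lemma mdvdZ_unit a (c : C) p : c != 0 -> mdvd a (c *: p) -> mdvd a p.
Proof. by move=> c0 /(mdvdZ c^-1); rewrite scalerA mulVf // scale1r. Qed.

Lemma mdvd_sum a (I : Type) (s : seq I) (P : pred I) (F : I -> {mpoly C[m]}) :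
  (forall i, P i -> mdvd a (F i)) -> mdvd a (\sum_(i <- s | P i) F i).
Proof. by move=> H; elim/big_ind: _ => //; [apply: mdvd0|apply: mdvdD]. Qed.

Lemma mdvd_exp a p i j : (i <= j)%N -> mdvd (a ^+ j) p -> mdvd (a ^+ i) p.
Proof.
by move=> ij [r ->]; exists (r * a ^+ (j - i)); rewrite -mulrA -exprD subnK.
Qed.

Lemma mdvd_mul2l a p q : a != 0 -> mdvd (a * p) (a * q) -> mdvd p q.
Proof.
move=> a0 [r]; rewrite mulrCA => E; exists r; exact: (mulfI a0 E).
Qed.

(** Congruence modulo [a] is compatible with sums and products, so it is enough to check it on the
    variables. *)
Lemma comp_mpoly_congr a (t : m.-tuple {mpoly C[m]}) p :
  (forall i, mdvd a ('X_i - tnth t i)) -> mdvd a (p - (p \mPo t)).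
Proof.
move=> at_; have cong (q r q' r' : {mpoly C[m]}) :
    mdvd a (q - q') -> mdvd a (r - r') -> mdvd a (q * r - q' * r').
  move=> qq rr;
    have -> : q * r - q' * r' = (q - q') * r + q' * (r - r') by ring.
  by apply: mdvdD; [apply: mdvdMr|apply: mdvdMl].
elim/mpolyind: p => [|c d p _ _ IH].
  by rewrite raddf0 subr0; apply: mdvd0.
rewrite comp_mpolyD comp_mpolyZ opprD addrACA; apply: mdvdD => //.
rewrite -scalerBr; apply: mdvdZ; rewrite comp_mpolyX (mpolyXE _ 1%g).
elim/big_ind2: _ => [||i _]; first by rewrite subrr; apply: mdvd0.
  by move=> ? ? ? ?; apply: cong.
rewrite perm1; elim: (d i) => [|e IHe]; first by rewrite subrr; apply: mdvd0.
by rewrite !exprS; apply: cong.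
Qed.

End Divisibility.

(* A linear form is normalised by a pivot coordinate of coefficient 1, which
   gives a projection onto its zero hyperplane. *)
Section LinearForm.

Variables (C : fieldType) (n : nat).
Local Notation m := (ncoord n).
Variables (alpha : 'rV[C]_m) (k : 'I_m).
Hypothesis alpha_k : alpha ord0 k = 1.

Definition lform : {mpoly C[m]} := \sum_i alpha ord0 i *: 'X_i.

Definition lform_proj : m.-tuple {mpoly C[m]} :=
  [tuple 'X_i - (i == k)%:R *: lform | i < m].

Lemma meval_lform v : lform.@[v] = \sum_i alpha ord0 i * v i.
Proof.
by rewrite /lform raddf_sum; apply: eq_bigr => i _; rewrite /= mevalZ mevalXU.
Qed.

Lemma mderiv_lform j : lform^`M(j) = (alpha ord0 j)%:MP.
Proof.
rewrite /lform raddf_sum (bigD1 j) //= big1 ?addr0.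
  by rewrite mderivZ mderivXU eqxx alg_mpolyC.
by move=> i ij; rewrite mderivZ mderivXU eq_sym (negPf ij) scaler0.
Qed.

Lemma lform_neq0 : lform != 0.
Proof.
apply/eqP => /(congr1 (fun p => p^`M(k))); rewrite mderiv_lform alpha_k.
by rewrite mderiv0 => /eqP; rewrite mpolyC_eq0 oner_eq0.
Qed.

Lemma lform_comp_proj : lform \mPo lform_proj = 0.
Proof.
rewrite {1}/lform raddf_sum /=.
transitivity (\sum_i (alpha ord0 i *: 'X_i - (alpha ord0 i * (i == k)%:R) *:
  lform)).
  apply: eq_bigr => i _;
    rewrite comp_mpolyZ comp_mpolyXU -tnth_nth tnth_mktuple.
  by rewrite scalerBr scalerA.
rewrite sumrB -/lform -scaler_suml (bigD1 k) //= big1 => [|i /negPf ->].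
  by rewrite eqxx alpha_k mulr1 addr0 scale1r subrr.
by rewrite mulr0.
Qed.

(** The substitution kills [lform] and moves each variable by a multiple of it, so its kernel is the
    ideal generated by [lform]. Since the target is a domain, [lform] is prime. *)
Lemma mdvd_lform p : mdvd lform p <-> p \mPo lform_proj = 0.
Proof.
split=> [[q ->]|p0]; first by rewrite rmorphM /= lform_comp_proj mulr0.
rewrite -[p]subr0 -p0; apply: comp_mpoly_congr => i.
by rewrite tnth_mktuple opprB addrCA subrr addr0; apply/mdvdZ/mdvd_refl.
Qed.

Lemma lform_prime p q : mdvd lform (p * q) -> mdvd lform p \/ mdvd lform q.
Proof.
rewrite !mdvd_lform rmorphM /= => /eqP; rewrite mulf_eq0.
by case/orP=> /eqP; [left|right].
Qed.

Lemma mdvd_lform_eval p :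
  mdvd lform p -> forall v, lform.@[v] = 0 -> p.@[v] = 0.
Proof. by move=> [r ->] v a0; rewrite mevalM a0 mulr0. Qed.

End LinearForm.

(** The projection lands in the hyperplane, so [p] composed with it vanishes at every point and is
    therefore the zero polynomial. *)
Lemma lform_nullstellensatz (C : numFieldType) n (alpha :
  'rV[C]_(ncoord n)) k p :
    alpha ord0 k = 1 ->
  (forall v, (lform alpha).@[v] = 0 -> p.@[v] = 0) -> mdvd (lform alpha) p.
Proof.
move=> ak p0; apply/(mdvd_lform ak)/mpoly_fun_eq0 => v.
rewrite comp_mpoly_meval; apply: p0.
by rewrite -comp_mpoly_meval lform_comp_proj // meval0.
Qed.

Section CoprimeProduct.

Variables (C : fieldType) (n : nat) (I : eqType).
Variable F : I -> {mpoly C[ncoord n]}.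

Hypothesis F0 : forall i, F i != 0.
Hypothesis F_nonunit : forall i, ~ mdvd (F i) 1.
Hypothesis F_prime :
  forall i p q, mdvd (F i) (p * q) -> mdvd (F i) p \/ mdvd (F i) q.

(** Primality moves one factor [F i] into [q]; after cancelling it, primality moves the second. *)
Lemma mdvd_sqr_cancel i p q :
  ~ mdvd (F i) p -> mdvd (F i ^+ 2) (p * q) -> mdvd (F i ^+ 2) q.
Proof.
move=> Fp Fpq; have [|//|[q1 q1E]] := @F_prime i p q.
  by rewrite -[F i]expr1; apply: (mdvd_exp _ Fpq).
have [|//|[q2 q2E]] := @F_prime i p q1; last first.
  by exists q2; rewrite q1E q2E -mulrA expr2.
apply: (mdvd_mul2l (F0 i)).
by case: Fpq => r E; exists r; rewrite mulrA -expr2 in E *; rewrite -E q1E;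
  ring.
Qed.

Lemma mdvd_prod_sqr (s : seq I) p : uniq s ->
    (forall i j, i \in s -> j \in s -> i != j -> ~ mdvd (F i) (F j)) ->
    (forall i, i \in s -> mdvd (F i ^+ 2) p) ->
  mdvd (\prod_(i <- s) F i ^+ 2) p.
Proof.
elim: s => [|i s IHs] /=; first by move=> *; exists p; rewrite big_nil mulr1.
case/andP=> is_ us Fij Fp; rewrite big_cons.
have [||r rE] := IHs us.
- by move=> j l js ls; apply: Fij; rewrite inE ?js ?ls orbT.
- by move=> j js; apply: Fp; rewrite inE js orbT.
(* Here [r] is the quotient of [p] by the product over the tail. The prime [F i] divides no factor
   of that product, so its square must divide [r]. *)
have [||t tE] := @mdvd_sqr_cancel i (\prod_(j <- s) F j ^+ 2) r.
- rewrite big_seq; elim/big_ind: _ => [||j js].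
  + exact: F_nonunit.
  + by move=> x y nx ny /F_prime[].
  + rewrite expr2 => /F_prime; have := Fij i j.
    rewrite !inE eqxx js orbT => /(_ isT isT).
    by case: eqP => [E|_ /(_ isT) ?]; [rewrite E js in is_|case].
- by rewrite mulrC -rE; apply: Fp; rewrite inE eqxx.
by exists t; rewrite rE tE -mulrA.
Qed.

End CoprimeProduct.

(** * Jacobian matrices along a hyperplane *)

Section RowReplacement.

Variables (R : comNzRingType) (m : nat).

Definition row_repl (M : 'M[R]_m) k (r : 'rV[R]_m) : 'M[R]_m :=
  \matrix_(i, j) if i == k then r ord0 j else M i j.

(** The cofactors along row [k] do not see row [k], so they are those of [M]. *)
Lemma det_row_repl M k r : \det (row_repl M k r) = (r *m \adj M) ord0 k.
Proof.
rewrite (expand_det_row _ k) mxE; apply: eq_bigr => j _.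
rewrite !mxE eqxx /cofactor; congr (_ * (_ * \det _)).
by apply/matrixP => x y; rewrite !mxE eq_sym (negPf (neq_lift _ _)).
Qed.

End RowReplacement.

(* If [det M = 0], some row of [M] is a combination of the others; replacing it by
   [alpha] gives an injective matrix. *)
Lemma adj_row_neq0 (F : fieldType) m (M : 'M[F]_m) (alpha : 'rV[F]_m) :
    (forall w : 'cV[F]_m, alpha *m w = 0 -> M *m w = 0 -> w = 0) ->
    \det M = 0 -> exists j, (alpha *m \adj M) ord0 j != 0.
Proof.
move=> inj /eqP /det0P[y y0 yM].
have /rV0Pn[j yj] := y0.
exists j; rewrite -det_row_repl -det_tr; apply/det0P => -[u u0 uN].
case/eqP: u0; apply: (can_inj (@trmxK _ _ _)); rewrite trmx0.
have {uN} Nu : row_repl M j alpha *m u^T = 0.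
  by apply: (can_inj (@trmxK _ _ _)); rewrite trmx_mul trmxK uN trmx0.
have alpha_u : alpha *m u^T = 0.
  apply/rowP => i; rewrite ord1 mxE; have /colP/(_ j) := Nu.
  by rewrite !mxE => E; rewrite -[RHS]E; apply: eq_bigr => l _;
    rewrite [row_repl _ _ _ _ _]mxE eqxx ord1.
have Mu i : i != j -> (M *m u^T) i ord0 = 0.
  move=> ij; have /colP/(_ i) := Nu; rewrite !mxE => E; rewrite -[RHS]E.
  by apply: eq_bigr => l _; rewrite [row_repl _ _ _ _ _]mxE (negPf ij).
apply: inj => //; apply/colP => i; rewrite [RHS]mxE.
have [->|/Mu//] := eqVneq i j.
(* All coordinates of [M *m u^T] except the [j]-th are known to vanish. Pairing with [y], whose
   [j]-th entry is nonzero, kills that one too. *)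
have : (y *m (M *m u^T)) ord0 ord0 = 0 by rewrite mulmxA yM mul0mx mxE.
rewrite mxE (bigD1 j) //= big1 => [|l /Mu ->]; last by rewrite mulr0.
by rewrite addr0 => /eqP; rewrite mulf_eq0 (negPf yj) => /eqP.
Qed.

Lemma mulmx_lin2l (R : comNzRingType) m p q (s t u : R) (A B : 'M[R]_(m, p))
    (N : 'M[R]_(p, q)) i j :
  ((s *: (t *: A + u *: B)) *m N) i j =
  s * (t * (A *m N) i j + u * (B *m N) i j).
Proof. by rewrite -scalemxAl mulmxDl -!scalemxAl !mxE. Qed.

Lemma mderivXn (R : comNzRingType) n i (p : {mpoly R[n]}) s :
  (p ^+ s.+1)^`M(i) = p ^+ s * p^`M(i) *+ s.+1.
Proof.
elim: s => [|s IHs]; first by rewrite expr1 expr0 mul1r.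
by rewrite exprS mderivM IHs [in RHS]mulrS exprS -mulrA mulrnAr mulrA -exprS;
  ring.
Qed.

Section Comb.

Variables (C : numFieldType) (n : nat).
Local Notation m := (ncoord n).
Implicit Types (alpha : 'rV[C]_m) (h : poly_lift C n).

Definition comb alpha h : {mpoly C[m]} := \sum_i alpha ord0 i *: h i.

Local Notation "alpha ^P" := (map_mx (@mpolyC m C) alpha)
  (at level 2, format "alpha ^P").

Lemma mul_const_row alpha p (N : 'M[{mpoly C[m]}]_(m, p)) j :
  (alpha^P *m N) ord0 j = \sum_i alpha ord0 i *: N i j.
Proof. by rewrite mxE; apply: eq_bigr => i _; rewrite mxE mul_mpolyC. Qed.

Lemma comb_jacobian alpha h :
  alpha^P *m jacobian_mx h = \row_j (comb alpha h)^`M(j).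
Proof.
apply/rowP => j; rewrite mul_const_row mxE /comb raddf_sum.
by apply: eq_bigr => i _; rewrite /= mxE mderivZ.
Qed.

(** Read the identity [alpha N adj(N) = det(N) alpha] at the pivot, where [alpha] is 1. *)
Lemma mdvd_det alpha k (N : 'M[{mpoly C[m]}]_m) b : alpha ord0 k = 1 ->
  (forall j, mdvd b ((alpha^P *m N) ord0 j)) -> mdvd b (\det N).
Proof.
move=> ak bN; have -> : \det N = (alpha^P *m N *m \adj N) ord0 k.
  by rewrite -mulmxA mul_mx_adj mul_mx_scalar !mxE ak mulr1.
by rewrite mxE; apply: mdvd_sum => j _; apply: mdvdMr.
Qed.

(** By [det_row_repl], entry [j] is the Jacobian determinant with row [j] replaced by [alpha]. *)
Definition adj_row alpha h := alpha^P *m \adj (jacobian_mx h).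

(** Write [a] for the form. By the chain rule [alpha J] is the gradient of [q a^(s+1)], that is
    [a^s ((s+1) q alpha + a grad q)]; multiply by the adjugate of [J]. *)
Lemma det_jacobian_comb alpha h s q j :
    comb alpha h = q * lform alpha ^+ s.+1 ->
  exists u, alpha ord0 j *: \det (jacobian_mx h) =
    lform alpha ^+ s * ((q * adj_row alpha h ord0 j) *+ s.+1 + lform alpha * u).
Proof.
move=> hq; set J := jacobian_mx h; set a := lform alpha.
exists (((\row_i q^`M(i)) *m \adj J) ord0 j).
have -> : alpha ord0 j *: \det J = (alpha^P *m J *m \adj J) ord0 j.
  by rewrite -mulmxA mul_mx_adj mul_mx_scalar !mxE mulrC mul_mpolyC.
have -> : alpha^P *m J =
    a ^+ s *: ((q *+ s.+1) *: alpha^P + a *: \row_i q^`M(i)).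
  rewrite comb_jacobian hq; apply/rowP => i; rewrite !mxE mderivM mderivXn.
  by rewrite mderiv_lform exprS -/a; ring.
by rewrite mulmx_lin2l mulrnAl.
Qed.

(** Cancelling [a^s] in [det_jacobian_comb] leaves [a] dividing [(s+1) q N_j], with [N_j] the entry
    of [adj_row]. As [a] is prime, does not divide [N_j], and [s+1] is invertible, [a] divides
    [q]. *)
Lemma comb_mdvd_step alpha k h s j : alpha ord0 k = 1 ->
    ~ mdvd (lform alpha) (adj_row alpha h ord0 j) ->
    mdvd (lform alpha ^+ s.+1) (\det (jacobian_mx h)) ->
    mdvd (lform alpha ^+ s.+1) (comb alpha h) ->
  mdvd (lform alpha ^+ s.+2) (comb alpha h).
Proof.
move=> ak aN aJ [q hq]; have a0 := lform_neq0 ak.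
have [u uE] := det_jacobian_comb j hq.
have := mdvdZ (alpha ord0 j) aJ; rewrite uE exprSr.
move=> /(mdvd_mul2l (expf_neq0 s a0)).
move/(mdvd_addIr (mdvdMr u (mdvd_refl _))); rewrite -scaler_nat.
move/mdvdZ_unit; rewrite pnatr_eq0 => /(_ isT) /(lform_prime ak)[[r rE]|//].
by exists r; rewrite hq rE [in RHS]exprS mulrA.
Qed.

Lemma eval_comb alpha h v :
  eval_at (lform alpha) (\col_i eval_at (h i) v) = eval_at (comb alpha h) v.
Proof.
rewrite /eval_at meval_lform /comb raddf_sum.
by apply: eq_bigr => i _; rewrite /= mxE mevalZ.
Qed.

Lemma eval_lform alpha (w : 'cV[C]_m) :
  eval_at (lform alpha) w = (alpha *m w) ord0 ord0.
Proof. by rewrite /eval_at meval_lform mxE. Qed.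

Lemma eval_adj_row alpha h (v : 'cV[C]_m) j :
  eval_at (adj_row alpha h ord0 j) v =
  (alpha *m \adj (map_mx (fun p => eval_at p v) (jacobian_mx h))) ord0 j.
Proof.
rewrite -[map_mx _ _]/(map_mx (meval (fun i => v i ord0)) _) -map_mx_adj.
rewrite /adj_row /eval_at mul_const_row raddf_sum [RHS]mxE.
by apply: eq_bigr => i _; rewrite /= mevalZ [map_mx _ _ _ _]mxE.
Qed.

Lemma comb_cube alpha k h : alpha ord0 k = 1 ->
    mdvd (lform alpha ^+ 2) (\det (jacobian_mx h)) ->
    restricts_dominantly h (lform alpha) ->
  mdvd (lform alpha ^+ 3) (comb alpha h).
Proof.
move=> ak aJ [hyp [v av inj]].
(* At [v] the determinant vanishes along with the form, while injectivity on the hyperplane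
   persists, so [adj_row_neq0] applies. *)
have [j jP] : exists j, eval_at (adj_row alpha h ord0 j) v != 0.
  have [||j] := @adj_row_neq0 _ _ (map_mx (fun p => eval_at p v) (jacobian_mx
    h)) alpha.
  - move=> w aw; apply: inj; by rewrite eval_lform aw mxE.
  - rewrite -[map_mx _ _]/(map_mx (meval (fun i => v i ord0)) _) det_map_mx.
    case: aJ => r ->; rewrite rmorphM rmorphXn /=.
    by have := av; rewrite /eval_at => ->; rewrite expr0n mulr0.
  by exists j; rewrite eval_adj_row.
have aN : ~ mdvd (lform alpha) (adj_row alpha h ord0 j).
  by move=> /mdvd_lform_eval/(_ _ av) E; move: jP; rewrite /eval_at E eqxx.
(* Two steps raise the exponent from 1 to 3. The starting point, divisibility by the form itself, is
   the invariance of the hyperplane. *)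
apply: (comb_mdvd_step ak aN) => //; apply: (comb_mdvd_step ak aN).
  exact: mdvd_exp aJ.
rewrite expr1; apply: (lform_nullstellensatz ak) => w aw.
have := hyp (\col_i w i); rewrite eval_comb /eval_at.
rewrite (@meval_eq _ _ _ w (lform _)) => [/(_ aw)|i]; last by rewrite mxE.
by rewrite (@meval_eq _ _ _ w (comb _ _)) => [|i]; last by rewrite mxE.
Qed.

End Comb.

(** * Degrees of determinants and derivatives *)

Section Homogeneity.

Variables (R : comNzRingType) (n : nat).
Implicit Type p : {mpoly R[n]}.

Lemma dhomog_prod_ord d r (F : 'I_r -> {mpoly R[n]}) :
  (forall i, F i \is d.-homog) -> \prod_i F i \is (r * d).-homog.
Proof.
elim: r F => [|r IHr] F Fd; first by rewrite big_ord0 dhomog1.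
by rewrite big_ord_recl mulSn; apply: dhomogM => //; apply: IHr.
Qed.

Lemma dhomog_det d r (M : 'M[{mpoly R[n]}]_r) :
  (forall i j, M i j \is d.-homog) -> \det M \is (r * d).-homog.
Proof.
move=> Md; apply: rpred_sum => s _; rewrite -signr_odd mulr_sign.
by case: (odd _); rewrite ?rpredN; apply: dhomog_prod_ord.
Qed.

Lemma dhomog_mderiv d p i : p \is d.+1.-homog -> p^`M(i) \is d.-homog.
Proof.
move=> pd; rewrite /mderiv big_seq; apply: rpred_sum => k kp.
have kd := dhomog_mf pd kp.
(* Exponents are subtracted with truncation, so monomials free of ['X_i] are set apart; their
   coefficient becomes 0. *)
have [->|ki] := eqVneq (k i) 0%N; first by rewrite mul0r scale0r rpred0.
apply: rpredZ; rewrite dhomogX; apply/eqP/succn_inj;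
  rewrite -kd -[RHS]/(mdeg k).
have /submK/(congr1 mdeg) <- : (U_(i) <= k)%MM;
  last by rewrite mdegD mdeg1 addn1.
by apply/mnm_lepP => j; rewrite mnm1E; case: eqP => // <-; rewrite lt0n.
Qed.

Lemma dhomog_msize_le d p : p \is d.-homog -> (msize p <= d.+1)%N.
Proof.
move=> pd; have [->|p0] := eqVneq p 0; first by rewrite msize0.
by rewrite -(mlead_deg p0) (dhomog_mf pd) // mlead_supp.
Qed.

Lemma dhomog_msizeE d p : p != 0 -> p \is d.-homog -> msize p = d.+1.
Proof. by move=> p0 pd;
  rewrite -(mlead_deg p0) (dhomog_mf pd) // mlead_supp. Qed.

End Homogeneity.

(** * Mirrors and the uniqueness argument *)

(* The pair (i, i) stands for the hyperplane u_i = 0 and the pair (i, j), with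
   i < j, for u_i = u_j. *)
Section Mirrors.

Variables (C : numFieldType) (n : nat).
Local Notation m := (ncoord n).
Implicit Types (p q : 'I_m * 'I_m).

Definition mirror_row p : 'rV[C]_m :=
  \row_l ((l == p.1)%:R - (p.1 != p.2)%:R * (l == p.2)%:R).

Definition mirror_form p := lform (mirror_row p).

(** Its degree [m * m.+1] is exactly that of the Jacobian determinant of a lift of degree [m.+2]. *)
Definition mirror_prod : {mpoly C[m]} :=
  \prod_(p : 'I_m * 'I_m | (p.1 <= p.2)%N) mirror_form p ^+ 2.

Lemma mirror_row_pivot p : mirror_row p ord0 p.1 = 1.
Proof. by rewrite mxE eqxx; case: eqP; rewrite ?mul0r ?mulr0 subr0. Qed.

Lemma sum_mirror_row (V : lmodType C) p (F : 'I_m -> V) :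
  \sum_i mirror_row p ord0 i *: F i = F p.1 - (p.1 != p.2)%:R *: F p.2.
Proof.
under eq_bigr do rewrite mxE scalerBl -scalerA.
rewrite sumrB -scaler_sumr (bigD1 p.1) //= big1 => [|i /negPf ->];
  last by rewrite scale0r.
rewrite (bigD1 p.2) //= big1 => [|i /negPf ->]; last by rewrite scale0r.
by rewrite !eqxx !scale1r !addr0.
Qed.

Lemma mirror_formE p : mirror_form p = 'X_p.1 - (p.1 != p.2)%:R *: 'X_p.2.
Proof. exact: sum_mirror_row. Qed.

Lemma mirror_form_neq0 p : mirror_form p != 0.
Proof. exact: lform_neq0 (mirror_row_pivot p). Qed.

Lemma meval_mirror_form p v :
  (mirror_form p).@[v] = v p.1 - (p.1 != p.2)%:R * v p.2.
Proof. by rewrite mirror_formE mevalB mevalZ !mevalXU. Qed.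

(** A point on the mirror of [p] and on no other. The values [l.+1] are distinct and nonzero;
    changing coordinate [p.1] alone creates a single incidence. *)
Definition mirror_point p : 'I_m -> C := fun l =>
  (if l == p.1 then if p.1 == p.2 then 0 else p.2.+1 else l.+1)%:R.

Lemma mirror_pointP p q : (p.1 <= p.2)%N -> (q.1 <= q.2)%N ->
  ((mirror_form q).@[mirror_point p] == 0) = (q == p).
Proof.
case: p q => [p1 p2] [q1 q2] /= p12 q12.
rewrite meval_mirror_form /= /mirror_point /= xpair_eqE.
have [<-{q2 q12}|q1q2] /= := eqVneq q1 q2.
  rewrite mul0r subr0 pnatr_eq0.
  case: (eqVneq q1 p1) => [->|//] /=; by case: (eqVneq p1 p2).
rewrite mul1r subr_eq0 eqr_nat.
move: p12 q12 q1q2; rewrite -!val_eqE /=.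
by do ![case: ifP => //]; lia.
Qed.

Lemma mirror_form_nonunit p : ~ mdvd (mirror_form p) 1.
Proof.
move=> /mdvd_lform_eval/(_ (fun=> 0)); rewrite meval1 meval_mirror_form.
by rewrite mulr0 subr0 => /(_ erefl) /eqP; rewrite oner_eq0.
Qed.

Lemma mirror_prod_mdvd (P : {mpoly C[m]}) :
  (forall p, (p.1 <= p.2)%N -> mdvd (mirror_form p ^+ 2) P) -> mdvd
    mirror_prod P.
Proof.
move=> FP; rewrite /mirror_prod -big_filter; set s := filter _ _.
have sE p : p \in s = (p.1 <= p.2)%N.
  by rewrite mem_filter mem_index_enum andbT.
apply: (@mdvd_prod_sqr _ _ _ mirror_form).
- exact: mirror_form_neq0.
- exact: mirror_form_nonunit.
- by move=> p; apply: lform_prime (mirror_row_pivot p).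
- by rewrite filter_uniq ?index_enum_uniq.
- move=> p q; rewrite !sE => p12 q12 pq /mdvd_lform_eval H.
  have := H (mirror_point p); have := mirror_pointP p12 p12.
  rewrite eqxx => /eqP -> /(_ erefl) /eqP.
  by rewrite mirror_pointP // eq_sym (negPf pq).
- by move=> p; rewrite sE; apply: FP.
Qed.

Lemma mirror_prod_split p : (p.1 <= p.2)%N ->
  exists2 r, mirror_prod = mirror_form p ^+ 2 * r & r.@[mirror_point p] != 0.
Proof.
move=> p12; rewrite /mirror_prod (bigD1 p) //=; eexists; first by [].
rewrite rmorph_prod; apply/prodf_neq0 => q /andP[q12 qp] /=.
by rewrite rmorphXn expf_neq0 //= mirror_pointP.
Qed.

Lemma mirror_prod_neq0 : mirror_prod != 0.
Proof. by apply/prodf_neq0 => p _; rewrite expf_neq0 // mirror_form_neq0. Qed.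

Lemma mirror_prod_order (c : C) p : c != 0 -> (p.1 <= p.2)%N ->
  vanishes_to_order (mirror_form p) (c *: mirror_prod) 2.
Proof.
move=> c0 p12; have [r -> rp] := mirror_prod_split p12; split.
  by apply: mdvdZ; exists r; rewrite mulrC.
move=> /(mdvdZ_unit c0); rewrite exprSr.
move=> /(mdvd_mul2l (expf_neq0 2 (mirror_form_neq0 p))) /mdvd_lform_eval H.
by case/eqP: rp; apply: H; apply/eqP; rewrite mirror_pointP.
Qed.

Section Uniqueness.

Variables (g h : poly_lift C n) (c : C).
Hypothesis g_homog : forall i, g i \is m.+2.-homog.
Hypothesis h_homog : forall i, h i \is m.+2.-homog.
Hypothesis c_neq0 : c != 0.
Hypothesis g_det : \det (jacobian_mx g) = c *: mirror_prod.
Hypothesis g_cube : forall p, (p.1 <= p.2)%N ->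
  mdvd (mirror_form p ^+ 3) (comb (mirror_row p) g).
Hypothesis h_cube : forall p, (p.1 <= p.2)%N ->
  mdvd (mirror_form p ^+ 3) (comb (mirror_row p) h).

Let J := jacobian_mx g.
Let hcol : 'cV_m := \col_i h i.

Let jac_row_sqr p : (p.1 <= p.2)%N ->
  forall j, mdvd (mirror_form p ^+ 2) ((comb (mirror_row p) g)^`M(j)).
Proof.
move=> p12 j; have [q ->] := g_cube p12; rewrite mderivM mderivXn.
apply: mdvdD; first by apply/mdvdMl/(@mdvd_exp _ _ _ _ 2 3)/mdvd_refl.
by rewrite -mulrnAr mulrCA; apply/mdvdMr/mdvd_refl.
Qed.

(* Cramer's rule: [\adj J *m hcol] is a vector of determinants of [J] with one
   column replaced by [h]. *)
Let cramer_mdvd j : mdvd mirror_prod ((\adj J *m hcol) j ord0).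
Proof.
apply: mirror_prod_mdvd => p p12.
have -> : (\adj J *m hcol) j ord0 = \det (row_repl J^T j hcol^T)^T.
  by rewrite det_tr det_row_repl -trmx_adj -trmx_mul [RHS]mxE.
apply: (mdvd_det (mirror_row_pivot p)) => l; rewrite mul_const_row.
have [->|lj] := eqVneq l j.
  under eq_bigr do rewrite [_^T _ _]mxE [row_repl _ _ _ _ _]mxE eqxx [_^T _
    _]mxE [hcol _ _]mxE.
  exact: (mdvd_exp _ (h_cube p12)).
under eq_bigr do rewrite [_^T _ _]mxE [row_repl _ _ _ _ _]mxE (negPf lj) [_^T
  _ _]mxE.
rewrite -mul_const_row comb_jacobian mxE; exact: jac_row_sqr.
Qed.

Let jac_homog i j : J i j \is m.+1.-homog.
Proof. by rewrite mxE; apply: dhomog_mderiv. Qed.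

Let cramer_homog j : (\adj J *m hcol) j ord0 \is (m * m.+1 + 1).-homog.
Proof.
rewrite mxE; apply: rpred_sum => i _;
  rewrite !mxE /cofactor -signr_odd mulr_sign.
(* A cofactor has size [n.-2], which is [m - 1], and entries of degree [m.+1]; the remaining [m.+2]
   comes from [h]. *)
have -> : (m * m.+1 + 1 = n.-2 * m.+1 + m.+2)%N by lia.
apply: dhomogM => //; case: (odd _); rewrite ?rpredN;
  by apply: dhomog_det => x y; rewrite !mxE dhomog_mderiv.
Qed.

(** Each Cramer numerator has degree one more than [mirror_prod], so the quotients [q] have degree
    at most 1. Multiplying back by the Jacobian matrix and cancelling [mirror_prod] expresses [h]
    through them. *)
Lemma linear_coefficients : exists2 q : 'I_m -> {mpoly C[m]},
  (forall j, (msize (q j) <= 2)%N) &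
  forall i, c *: h i = \sum_j (g i)^`M(j) * q j.
Proof.
have [q qE] := fin_all_exists cramer_mdvd.
exists q => [j|i].
  have [->|q0] := eqVneq (q j) 0; first by rewrite msize0.
  have := dhomog_msize_le (cramer_homog j).
  rewrite qE msizeM ?mirror_prod_neq0 //.
  have -> : msize mirror_prod = (m * m.+1).+1.
    rewrite -(msizeZ _ c_neq0) -g_det; apply: dhomog_msizeE.
      by rewrite g_det scaler_eq0 negb_or c_neq0 mirror_prod_neq0.
    exact: dhomog_det jac_homog.
  by move: (msize (q j)) => d; lia.
apply: (mulIf mirror_prod_neq0).
have : (J *m (\adj J *m hcol)) i ord0 = \det J * h i.
  by rewrite mulmxA mul_mx_adj mul_scalar_mx !mxE.
rewrite mxE g_det => E;
  rewrite -scalerAl [_ * mirror_prod]mulrC scalerAl -E mulr_suml.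
by apply: eq_bigr => j _; rewrite qE mulrA [J i j]mxE.
Qed.

(** The direction on the right depends on [g] alone, so any two maps satisfying the cube conditions
    are multiples of one vector. *)
Lemma cubes_radial : exists lambda : C,
  forall i, h i = lambda *: \sum_j (g i)^`M(j) * 'X_j.
Proof.
have [q q_size qE] := linear_coefficients.
have q_mirror p :
  (p.1 <= p.2)%N -> mdvd (mirror_form p) (comb (mirror_row p) q).
  move=> p12; have [t tE] := g_cube p12.
  have a0 := mirror_form_neq0 p.
  (* If [a] divided [t], then [a^4] would divide [a(g)], hence [a^3] would divide the determinant,
     whose order along [a] is exactly 2. *)
  have nt : ~ mdvd (mirror_form p) t.
    move=> [t' t'E].
    have [|u] := @det_jacobian_comb _ _ (mirror_row p) g 3 t' p.1.
      by rewrite tE t'E -mulrA -exprS.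
    rewrite mirror_row_pivot scale1r => uE.
    have [_ []] := mirror_prod_order c_neq0 p12; rewrite -g_det uE.
    exact/mdvdMr/mdvd_refl.
  have combE :
    c *: comb (mirror_row p) h = \sum_j (comb (mirror_row p) g)^`M(j) * q j.
    rewrite /comb scaler_sumr.
    under eq_bigr do rewrite scalerA mulrC -scalerA qE.
    rewrite (eq_bigr (fun i => \sum_j (mirror_row p ord0 i *: (g i)^`M(j)) * q
      j)).
      rewrite exchange_big; apply: eq_bigr => j _;
        rewrite -mulr_suml raddf_sum /=.
      by congr (_ * _); apply: eq_bigr => i _; rewrite mderivZ.
    by move=> i _; rewrite scaler_sumr; apply: eq_bigr => j _; rewrite scalerAl.
  have : mdvd (mirror_form p ^+ 3) (c *: comb (mirror_row p) h).
    exact/mdvdZ/h_cube.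
  (* Differentiating [a(g) = t a^3] gives [3 a^2 t alpha_j] modulo [a^3]. Thus [a] divides [t a(q)],
     and so [a(q)]. *)
  have -> : c *: comb (mirror_row p) h = mirror_form p ^+ 2 *
      ((t * comb (mirror_row p) q) *+ 3) +
      (\sum_j t^`M(j) * q j) * mirror_form p ^+ 3.
    rewrite combE tE /comb mulr_suml mulr_sumr -sumrMnl mulr_sumr -big_split.
    apply: eq_bigr => j _;
      rewrite mderivM mderivXn mderiv_lform -/(mirror_form p).
    by rewrite /= -mul_mpolyC; ring.
  move=> /(mdvd_addIr (mdvdMl _ (mdvd_refl _))); rewrite exprSr.
  move=> /(mdvd_mul2l (expf_neq0 2 a0)); rewrite -scaler_nat => /mdvdZ_unit;
    rewrite pnatr_eq0 => /(_ isT).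
  by move=> /(lform_prime (mirror_row_pivot p))[].
(* The mirror [u_i = 0] makes ['X_i] divide [q i], and the degree bound leaves a constant
   quotient. *)
have q_lin i : exists l : C, q i = l *: 'X_i.
  have := q_mirror (i, i) (leqnn _).
  rewrite /comb sum_mirror_row mirror_formE /= eqxx /= !scale0r !subr0 => -[s
    sE].
  have [s0|s0] := eqVneq s 0; first by exists 0; rewrite sE s0 mul0r scale0r.
  have X0 : 'X_i != 0 :> {mpoly C[m]} by rewrite -msize_poly_eq0 msizeX.
  have := q_size i; rewrite sE msizeM // msizeX mdeg1 addnS /= addn1 ltnS.
  by move=> /msize1_polyC ->; exists (s@_0%MM); rewrite mul_mpolyC.
have [l lE] := fin_all_exists q_lin.
(* The all-ones point lies on every mirror [u_i = u_j]; evaluating there compares the two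
   constants. *)
have l_const (i j : 'I_m) : (i < j)%N -> l i = l j.
  move=> ij; have ne : i != j by apply: contraTneq ij => ->; rewrite ltnn.
  have := q_mirror (i, j) (ltnW ij).
  rewrite /comb sum_mirror_row /= ne scale1r => /mdvd_lform_eval/(_ (fun=> 1)).
  rewrite -/(mirror_form (i, j)) meval_mirror_form /= ne mul1r subrr => /(_
    erefl).
  by rewrite !lE mevalB !mevalZ !mevalXU !mulr1 => /eqP;
    rewrite subr_eq0 => /eqP.
have l0 i : l i = l ord0.
  have [->//|i0] := eqVneq i ord0; apply/esym/l_const.
  by rewrite lt0n.
exists (c^-1 * l ord0) => i; apply: (can_inj (scalerK c_neq0)).
rewrite qE scalerA mulrA divff // mul1r scaler_sumr; apply: eq_bigr => j _.
by rewrite lE l0 scalerAr.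
Qed.

End Uniqueness.

End Mirrors.

(** * The map g *)

Lemma poly_primitive_inj (C : numFieldType) n (p q : {poly {mpoly C[n]}}) :
  p^`() = q^`() -> p.[0] = q.[0] -> p = q.
Proof.
rewrite !horner_coef0 => dpq pq0; apply/polyP => -[//|k].
have := congr1 (fun r : {poly _} => r`_k) dpq;
  rewrite !coef_deriv -!(scaler_nat k.+1).
by apply: scalerI; rewrite pnatr_eq0.
Qed.

(** Total derivative of [p(x)] when both the coefficients and the argument depend on the
    variables. *)
Lemma mderiv_horner (R : comNzRingType) n i N (c : nat -> {mpoly R[n]})
    (e : nat -> nat) x (p := \sum_(j < N) c j *: 'X^(e j)) :
  (p.[x])^`M(i) =
  \sum_(j < N) (c j)^`M(i) * x ^+ e j + p^`().[x] * x^`M(i).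
Proof.
rewrite /p horner_sum !raddf_sum horner_sum mulr_suml -big_split.
apply: eq_bigr => j _ /=.
rewrite hornerZ hornerXn derivZ derivXn hornerZ hornerMn hornerXn mderivM.
congr (_ + _); case: (e j) => [|k]; last by rewrite mderivXn; ring.
by rewrite expr0 -mpolyC1 mderivC; ring.
Qed.

(** Translating the roots by [- x ord0] sends the extra root 0 to [- x ord0] and the root [x ord0]
    to 0: the two merely trade places. *)
Lemma translate_root_poly (R : comNzRingType) r (x : 'I_r.+1 -> R) :
  'X * \prod_i ('X - ((if i == ord0 then 0 else x i) - x ord0)%:P) =
  ('X * \prod_i ('X - (x i)%:P)) \Po ('X + (x ord0)%:P).
Proof.
have shift y : ('X - y%:P) \Po ('X + (x ord0)%:P) = 'X - (y - x ord0)%:P.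
  by rewrite comp_polyB comp_polyX comp_polyC polyCB opprB addrA addrAC.
rewrite comp_polyM comp_polyX rmorph_prod /=;
  under [in RHS]eq_bigr do rewrite shift.
rewrite (bigD1 ord0) //= [in RHS](bigD1 ord0) //= subrr polyC0 subr0 sub0r
  polyCN opprK.
rewrite mulrCA; congr (_ * (_ * _)).
by apply: eq_bigr => i /negPf ->.
Qed.

Section Primitive.

Variables (C : numFieldType) (n : nat).
Local Notation m := (ncoord n).

Definition root_poly : {poly {mpoly C[m]}} := \prod_(i < m) ('X - ('X_i)%:P).

(* The primitive, vanishing at 0, of t * (t - u_1) * ... * (t - u_m). *)
Definition prim_poly : {poly {mpoly C[m]}} :=
  \sum_(j < m.+1) ((j.+2%:R : C)^-1 *: root_poly`_j) *: 'X^(j.+2).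

Lemma size_root_poly : size root_poly = m.+1.
Proof. by rewrite /root_poly -big_enum size_prod_XsubC size_enum_ord. Qed.

Lemma root_poly_lead : root_poly`_m = 1.
Proof.
have := monic_prod_XsubC (index_enum 'I_m) xpredT (fun i => 'X_i :
  {mpoly C[m]}).
by move=> /monicP; rewrite -/root_poly lead_coefE size_root_poly.
Qed.

Lemma root_polyE : root_poly = \sum_(j < m.+1) root_poly`_j *: 'X^j.
Proof. by rewrite -poly_def -size_root_poly coefK. Qed.

Lemma root_poly_root l : root_poly.['X_l] = 0.
Proof. by rewrite /root_poly (bigD1 l) //= hornerM hornerXsubC subrr mul0r. Qed.

Lemma deriv_root_poly l :
  root_poly^`().['X_l] = \prod_(i < m | i != l) ('X_l - 'X_i).
Proof.
rewrite /root_poly (bigD1 l) //= derivM derivXsubC !hornerE subrr mul0r addr0.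
by rewrite horner_prod; apply: eq_bigr => i _; rewrite hornerXsubC.
Qed.

Lemma deriv_prim_poly : prim_poly^`() = 'X * root_poly.
Proof.
rewrite /prim_poly raddf_sum [in RHS]root_polyE mulr_sumr;
  apply: eq_bigr => j _ /=.
rewrite derivZ derivXn -scalerAr -exprS -scaler_nat scalerA /=.
congr (_ *: _); rewrite mulr_natr -scaler_nat scalerA divff ?scale1r //.
by rewrite pnatr_eq0.
Qed.

Lemma prim_poly0 : prim_poly.[0] = 0.
Proof.
rewrite /prim_poly horner_sum big1 // => j _.
by rewrite hornerZ hornerXn expr0n mulr0.
Qed.

Lemma prim_poly_horner l : prim_poly.['X_l] =
  \sum_(j < m.+1) (j.+2%:R : C)^-1 *: (root_poly`_j * 'X_l ^+ j.+2).
Proof.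
rewrite /prim_poly horner_sum; apply: eq_bigr => j _.
by rewrite hornerZ hornerXn scalerAl.
Qed.

Lemma mesym_root_poly k : (k <= m)%N ->
  root_poly`_(m - k) = (-1) ^+ k *: mesym m C k.
Proof.
rewrite -ltnS => km; pose X : m.-tuple {mpoly C[m]} := [tuple 'X_i | i < m].
have := mroots_coeff X (Ordinal km); rewrite big_tuple /=.
under eq_bigr do rewrite tnth_mktuple.
rewrite -/root_poly => ->.
rewrite -signr_odd mulr_sign -[in RHS]signr_odd scaler_sign.
have -> : (mesym m {mpoly C[m]} k).@[tnth X] = mesym m C k; last by [].
rewrite /mesym raddf_sum; apply: eq_bigr => h _ /=.
by rewrite rmorph_prod; apply: eq_bigr => i _ /=; rewrite mevalXU tnth_mktuple.
Qed.

(** The coefficients satisfy [(k+1)/(k+3) = 1 - 2/(k+3)]. The part with constant 1 rebuilds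
    ['X_l ^+ 2] times [root_poly] at its root ['X_l], which is 0; the other part is the
    primitive. *)
Lemma g_map_prim (hn : (2 <= n)%N) l :
  g_map C n l = (2 * (-1) ^+ m) *: prim_poly.['X_l].
Proof.
have range a b (F : nat -> {mpoly C[m]}) :
  a = b -> \sum_(k < a) F k = \sum_(k < b) F k by move->.
rewrite /g_map (@range _ m (fun k => G_coef C k *: ('X_l ^+ k * mesym m C (n -
  2 - k))));
  last by lia.
have -> : 2 * (-1) ^+ m *: prim_poly.['X_l] =
   - ((-1) ^+ m *: ('X_l ^+ 2 * root_poly.['X_l] - 2 *: prim_poly.['X_l])).
  by rewrite root_poly_root mulr0 sub0r scalerN opprK scalerA mulrC.
rewrite prim_poly_horner {1}root_polyE horner_sum !mulr_sumr scaler_sumr -sumrB.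
(* The constant term of [root_poly] drops out because its factor is [1 - 2/2]; the index then shifts
   to [j = k + 1]. *)
rewrite [in RHS]big_ord_recl /= hornerZ hornerXn mulr1 scalerA.
rewrite divff ?pnatr_eq0 // scale1r [root_poly`_0 * _]mulrC subrr add0r.
rewrite scaler_sumr -sumrN; apply: eq_bigr => j _.
rewrite /bump leq0n add1n; case: j => k km /=; rewrite hornerZ hornerXn.
have -> : mesym m C (n - 2 - k) = (-1) ^+ (n - 2 - k) *: root_poly`_k.+1.
  have := @mesym_root_poly (n - 2 - k);
    have -> : (m - (n - 2 - k) = k.+1)%N by lia.
  by move=> -> //; [rewrite scalerA -exprMn mulrNN mulr1 expr1n scale1r | lia].
have -> : (-1) ^+ m = - ((-1) ^+ k * (-1) ^+ (n - 2 - k)) :> C.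
  transitivity ((-1) ^+ (k + (n - 2 - k)).+1 : C);
    last by rewrite exprS mulN1r exprD.
  by congr (_ ^+ _); lia.
set P := root_poly`_k.+1; set X := 'X_l; set s := (-1) ^+ (n - 2 - k).
have -> : X ^+ 2 * (P * X ^+ k.+1) = P * X ^+ k.+3.
  by rewrite mulrCA -exprD.
rewrite -[X in _ *: (X - _)]scale1r [2 *: _]scalerA -scalerBl scalerA -scaleNr.
rewrite -!scalerAr -scalerA mulrA -exprD [_ * P]mulrC !scalerA; congr (_ *: _).
have k3 : k.+3%:R != 0 :> C by rewrite pnatr_eq0.
have k3E : k.+3%:R = 2 + k.+1%:R :> C by rewrite -natrD.
rewrite k3E in k3 *; rewrite mulNr opprK.
move: k.+1%:R s ((-1) ^+ k) k3 => x y z x2; field; exact: x2.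
Qed.

(** Varying the upper limit contributes the integrand at its root ['X_l], which is 0. Only
    coefficients are differentiated, and the leading one is constant, hence the range [j < m]. *)
Lemma g_map_jacobian (hn : (2 <= n)%N) l i : (g_map C n l)^`M(i) =
  (2 * (-1) ^+ m) *: \sum_(j < m) 'X_l ^+ j.+2 * ((j.+2%:R : C)^-1 *:
    root_poly`_j^`M(i)).
Proof.
rewrite g_map_prim // mderivZ; congr (_ *: _).
have := @mderiv_horner _ _ i m.+1 (fun j => (j.+2%:R : C)^-1 *: root_poly`_j)
  (fun j => j.+2) 'X_l; rewrite -/prim_poly => ->.
rewrite deriv_prim_poly hornerM root_poly_root mulr0 mul0r addr0.
rewrite big_ord_recr /= root_poly_lead mderivZ -mpolyC1 mderivC scaler0 mul0r
  addr0.
by apply: eq_bigr => j _; rewrite mderivZ mulrC.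
Qed.

(** Differentiate the identity [root_poly.['X_l] = 0]. This makes the Vandermonde matrix times the
    Jacobian matrix of the coefficients diagonal. *)
Lemma root_poly_jacobian l i :
  \sum_(j < m) 'X_l ^+ j * root_poly`_j^`M(i) =
  (- root_poly^`().['X_l]) *+ (i == l).
Proof.
have := root_poly_root l; move/(congr1 (mderiv i)); rewrite mderiv0.
have := @mderiv_horner _ _ i m.+1 (fun j => root_poly`_j) id 'X_l.
rewrite -root_polyE => ->; rewrite big_ord_recr /= root_poly_lead.
rewrite -mpolyC1 mderivC mul0r addr0 mderivXU => /(canRL (addrK _)).
rewrite sub0r; under eq_bigr do rewrite mulrC.
by move=> ->; rewrite mulr_natr mulNrn.
Qed.

(** Each unordered pair occurs on the left once in each order, so it contributes a squared
    difference and a sign. *)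
Lemma mirror_prod_sign : exists2 c : C, c != 0 &
  \prod_l ('X_l ^+ 2 * \prod_(i < m | i != l) ('X_l - 'X_i)) = c *:
    mirror_prod C n.
Proof.
have -> : mirror_prod C n =
    \prod_l ('X_l ^+ 2 * \prod_(i < m | (l < i)%N) ('X_l - 'X_i) ^+ 2).
  rewrite /mirror_prod -(pair_big_dep xpredT (fun i j : 'I_m => (i <= j)%N)
    (fun i j => mirror_form C (i, j) ^+ 2)) /=.
  apply: eq_bigr => l _; rewrite (bigD1 l) //=; congr (_ * _).
    by rewrite mirror_formE /= eqxx scale0r subr0.
  rewrite [LHS](eq_bigl (fun i : 'I_m => (l < i)%N)) => [|i]; last first.
    by rewrite -val_eqE /=; lia.
  apply: eq_bigr => i li; rewrite mirror_formE /=.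
  by rewrite -val_eqE /= neq_ltn li scale1r.
rewrite !big_split /=.
exists (\prod_(l < m) \prod_(i < m | (l < i)%N) -1).
  by apply/prodf_neq0 => l _; apply/prodf_neq0 => i _;
    rewrite oppr_eq0 oner_eq0.
rewrite scalerAr; congr (_ * _).
transitivity (\prod_(l < m) \prod_(i < m | (l < i)%N) ('X_l - 'X_i : {mpoly
  C[m]}) *
              \prod_(l < m) \prod_(i < m | (i < l)%N) ('X_l - 'X_i)).
  rewrite -big_split; apply: eq_bigr => l _.
  rewrite (bigID (fun i : 'I_m => (l < i)%N)) /=; congr (_ * _);
    apply: eq_bigl => i.
    by rewrite -val_eqE /=; lia.
  by rewrite -val_eqE /=; lia.
rewrite [X in _ * X](exchange_big_dep xpredT) //= -big_split -scaler_prod.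
apply: eq_bigr => l _; rewrite -big_split -scaler_prod.
by apply: eq_bigr => i _; rewrite scaleN1r /=; ring.
Qed.

(** The Jacobian matrix is [diag * W * diag * B]. Only the product [\det W * \det B] is needed, and
    [W *m B] is diagonal by [root_poly_jacobian]. *)
Lemma det_g_map (hn : (2 <= n)%N) : exists2 c : C, c != 0 &
  \det (jacobian_mx (g_map C n)) = c *: mirror_prod C n.
Proof.
pose W : 'M[{mpoly C[m]}]_m := \matrix_(l, j) 'X_l ^+ j.
pose B : 'M[{mpoly C[m]}]_m := \matrix_(j, i) root_poly`_j^`M(i).
pose kappa (j : 'I_m) : C := 2 * (-1) ^+ m / j.+2%:R.
have -> : jacobian_mx (g_map C n) = diag_mx (\row_l 'X_l ^+ 2) *m W *m
    diag_mx (\row_j (kappa j)%:MP) *m B.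
  apply/matrixP => l i; rewrite mxE g_map_jacobian // mxE scaler_sumr.
  apply: eq_bigr => j _; rewrite mul_mx_diag mxE mul_diag_mx !mxE.
  rewrite -scalerAr scalerA -/(kappa j) -exprD add2n -mulrA mul_mpolyC.
  by rewrite scalerAr.
rewrite !det_mulmx !det_diag.
have WB : \det W * \det B = \prod_l - root_poly^`().['X_l].
  rewrite -det_mulmx (_ : W *m B = diag_mx (\row_l - root_poly^`().['X_l])).
    by rewrite det_diag; apply: eq_bigr => l _; rewrite mxE.
  apply/matrixP => l i; rewrite mxE [RHS]mxE eq_sym mxE -root_poly_jacobian.
  by apply: eq_bigr => j _; rewrite !mxE.
have [c c0 cE] := mirror_prod_sign.
exists ((\prod_j kappa j) * (\prod_(l < m) -1) * c).
  rewrite !mulf_neq0 //; apply/prodf_neq0 => j _;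
    last by rewrite oppr_eq0 oner_eq0.
  by rewrite !mulf_neq0 ?signr_eq0 ?invr_eq0 ?pnatr_eq0.
have regroup (x y z t : {mpoly C[m]}) :
  x * y * z * t = z * (x * (y * t)) by ring.
rewrite regroup WB -scalerA -cE.
have -> : \prod_i (\row_j (kappa j)%:MP :
  'rV[{mpoly C[m]}]_m) ord0 i = (\prod_j kappa j)%:MP.
  by rewrite rmorph_prod; apply: eq_bigr => j _; rewrite mxE.
rewrite mul_mpolyC -scalerA; congr (_ *: _).
rewrite -big_split -scaler_prod; apply: eq_bigr => l _ /=.
by rewrite mxE deriv_root_poly scaleN1r mulrN.
Qed.

(** As polynomials in the integration variable, the substituted primitive and the translated one
    minus a constant share their derivative and vanish at 0. *)
Lemma prim_poly_comp (t : m.-tuple {mpoly C[m]}) x0 l :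
    'X * \prod_(i < m) ('X - (tnth t i)%:P) = ('X * root_poly) \Po ('X +
      x0%:P) ->
  prim_poly.['X_l] \mPo t = prim_poly.[tnth t l + x0] - prim_poly.[x0].
Proof.
move=> tE; have mapE : map_poly (comp_mpoly t) prim_poly =
    prim_poly \Po ('X + x0%:P) - (prim_poly.[x0])%:P.
  apply: poly_primitive_inj; last first.
    rewrite hornerD hornerN hornerC horner_comp hornerD hornerX hornerC add0r
      subrr.
    rewrite horner_coef0 coef_map /=.
    by rewrite -horner_coef0 prim_poly0 raddf0.
  rewrite deriv_map deriv_prim_poly derivB deriv_comp deriv_prim_poly derivC
    subr0.
  rewrite derivD derivX derivC addr0 mulr1 -tE rmorphM /= map_polyX;
    congr (_ * _).
  rewrite rmorph_prod; apply: eq_bigr => i _ /=.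
  by rewrite rmorphB /= map_polyX map_polyC /= comp_mpolyXU -tnth_nth.
rewrite -[LHS]/(comp_mpoly t _) -horner_map /= mapE comp_mpolyXU -tnth_nth.
by rewrite hornerD hornerN hornerC horner_comp hornerD hornerX hornerC.
Qed.

(** * Equivariance of [g] *)

Definition linear_tuple (A : 'M[C]_m) : m.-tuple {mpoly C[m]} :=
  [tuple \sum_(k < m) A j k *: 'X_k | j < m].

Lemma tnth_linear_tuple A j :
  tnth (linear_tuple A) j = \sum_(k < m) A j k *: 'X_k.
Proof. by rewrite tnth_mktuple. Qed.

Lemma perm_mx_row (V : lmodType C) (s : 'S_m) i (F : 'I_m -> V) :
  \sum_(k < m) (perm_mx s : 'M[C]_m) i k *: F k = F (s i).
Proof.
rewrite (bigD1 (s i)) //= big1 => [|k ksi];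
  first by rewrite !mxE eqxx scale1r addr0.
by rewrite !mxE eq_sym (negPf ksi) scale0r.
Qed.

Lemma T_mx_row (V : lmodType C) i (F : 'I_m -> V) :
  \sum_(k < m) T_mx C n i k *: F k = (if i == ord0 then 0 else F i) - F ord0.
Proof.
have delta j : \sum_(k < m) (k == j)%:R *: F k = F j.
  rewrite (bigD1 j) //= big1 => [|k /negPf ->]; last by rewrite scale0r.
  by rewrite eqxx scale1r addr0.
under eq_bigr do rewrite mxE; case: eqP => _.
  by under eq_bigr do rewrite scaleNr; rewrite sumrN delta sub0r.
by under eq_bigr do rewrite scalerBl; rewrite sumrB !delta.
Qed.

Hypothesis hn : (2 <= n)%N.

Lemma precomp_g_map (A : 'M[C]_m) l : precomp (g_map C n) A l =
  (2 * (-1) ^+ m) *: (prim_poly.['X_l] \mPo linear_tuple A).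
Proof. by rewrite /precomp g_map_prim // comp_mpolyZ. Qed.

Lemma tnth_perm_tuple (s : 'S_m) j :
  tnth (linear_tuple (perm_mx s)) j = 'X_(s j).
Proof. by rewrite tnth_linear_tuple perm_mx_row. Qed.

Lemma tnth_T_tuple j :
  tnth (linear_tuple (T_mx C n)) j = (if j == ord0 then 0 else 'X_j) - 'X_ord0.
Proof. by rewrite tnth_linear_tuple T_mx_row. Qed.

Lemma prim_poly_perm (s : 'S_m) l :
  prim_poly.['X_l] \mPo linear_tuple (perm_mx s) = prim_poly.['X_(s l)].
Proof.
have tE : 'X * \prod_(i < m) ('X - (tnth (linear_tuple (perm_mx s)) i)%:P) =
    ('X * root_poly) \Po ('X + (0 : {mpoly C[m]})%:P).
  rewrite [in RHS]polyC0 [in RHS]addr0 comp_polyXr.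
  have -> // :
    \prod_(i < m) ('X - (tnth (linear_tuple (perm_mx s)) i)%:P) = root_poly.
  rewrite /root_poly [RHS](reindex_inj (@perm_inj _ s)); apply: eq_bigr => i _.
  by rewrite tnth_perm_tuple.
by rewrite (prim_poly_comp _ tE) tnth_perm_tuple addr0 prim_poly0 subr0.
Qed.

Lemma prim_poly_T l : prim_poly.['X_l] \mPo linear_tuple (T_mx C n) =
  prim_poly.[if l == ord0 then 0 else 'X_l] - prim_poly.['X_ord0].
Proof.
have tE : 'X * \prod_(i < m) ('X - (tnth (linear_tuple (T_mx C n)) i)%:P) =
    ('X * root_poly) \Po ('X + ('X_ord0 : {mpoly C[m]})%:P).
  have -> : \prod_(i < m) ('X - (tnth (linear_tuple (T_mx C n)) i)%:P) =
      \prod_(i < m) ('X - ((if i == ord0 then 0 else 'X_i) - 'X_ord0)%:P).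
    by apply: eq_bigr => i _; rewrite tnth_T_tuple.
  exact: (translate_root_poly (fun i : 'I_m => 'X_i : {mpoly C[m]})).
by rewrite (prim_poly_comp _ tE) tnth_T_tuple subrK.
Qed.

Lemma g_map_perm (s : 'S_m) l :
  precomp (g_map C n) (perm_mx s) l = g_map C n (s l).
Proof. by rewrite precomp_g_map prim_poly_perm g_map_prim. Qed.

Lemma g_map_T l : precomp (g_map C n) (T_mx C n) l =
  (if l == ord0 then 0 else g_map C n l) - g_map C n ord0.
Proof.
rewrite precomp_g_map prim_poly_T !g_map_prim // scalerBr.
by case: eqP => _ //; rewrite prim_poly0 scaler0.
Qed.

(** The generators are checked on polynomials. Products and inverses are handled on functions, where
    equivariance reads [gv (B *m v) = B *m gv v]. *)
Lemma g_map_G_n A :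
  G_n A -> forall l, precomp (g_map C n) A l = postcomp A (g_map C n) l.
Proof.
pose gv (v : 'cV[C]_m) : 'cV[C]_m := \col_i (g_map C n i).@[fun k => v k ord0].
have precompE B l (v : 'I_m -> C) :
    (precomp (g_map C n) B l).@[v] = gv (B *m \col_i v i) l ord0.
  rewrite comp_mpoly_meval mxE; apply: meval_eq => i.
  rewrite tnth_linear_tuple raddf_sum mxE; apply: eq_bigr => k _ /=.
  by rewrite mevalZ mevalXU mxE.
have postcompE B l (v : 'I_m -> C) :
    (postcomp B (g_map C n) l).@[v] = (B *m gv (\col_i v i)) l ord0.
  rewrite raddf_sum mxE; apply: eq_bigr => k _ /=.
  by rewrite mevalZ !mxE; congr (_ * _); apply: meval_eq => i; rewrite mxE.
have equivE B :
  (forall l, precomp (g_map C n) B l = postcomp B (g_map C n) l) <->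
    (forall v, gv (B *m v) = B *m gv v).
  split=> [E v|E l].
    apply/colP => l; have -> : v = \col_i v i ord0 by apply/colP => i;
      rewrite mxE.
    by rewrite -precompE E postcompE.
  apply/eqP; rewrite -subr_eq0; apply/eqP/mpoly_fun_eq0 => v.
  by rewrite mevalB precompE postcompE E subrr.
elim=> [s|||B D _ IHB _ IHD|B _ IHB].
- by move=> l; rewrite g_map_perm /postcomp perm_mx_row.
- by move=> l; rewrite g_map_T /postcomp T_mx_row.
- by apply/equivE => v; rewrite !mul1mx.
- by apply/equivE => v; rewrite -!mulmxA (equivE B).1 // (equivE D).1.
(* [invmx] returns a singular matrix unchanged, which leaves the induction hypothesis itself. *)
apply/equivE => v; have [uB|nB] := boolP (B \in unitmx); last first.
  by rewrite invmx_out // (equivE B).1.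
by rewrite -[in RHS](mulKVmx uB v) (equivE B).1 // mulKmx.
Qed.

Lemma g_map_equivariant : equivariant (g_map C n).
Proof. by move=> A /g_map_G_n E i j; rewrite !E mulrC. Qed.

(** * Degree of [g] and cubes of the mirror forms *)

Lemma g_map_homog l : g_map C n l \is n.+1.-homog.
Proof.
rewrite /g_map; have -> : n.+1 = (1 * 3 + n.-2)%N by lia.
have X_homog : 'X_l \is [in C[m], 1.-homog] by rewrite dhomogX; apply/eqP/mdeg1.
apply: dhomogM; first exact: dhomogMn.
apply: rpred_sum => k _; apply: rpredZ.
have kE : (1 * k + (n - 2 - k))%N = n.-2 by have := ltn_ord k; lia.
by have := dhomogM (dhomogMn k X_homog) (dhomog_mesym m C (n - 2 - k));
  rewrite kE.
Qed.

Lemma mdvd_diff_comp (h : poly_lift C n) (t : m.-tuple {mpoly C[m]}) (s :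
  'I_m -> 'I_m) e k l :
    (forall i, h i \mPo t = h (s i)) -> (forall i, tnth t i = 'X_(s i)) ->
    mdvd (('X_k - 'X_l) ^+ e) (h k - h l) ->
  mdvd (('X_(s k) - 'X_(s l)) ^+ e) (h (s k) - h (s l)).
Proof.
move=> hs ts [r rE]; exists (r \mPo t);
  rewrite -!hs -comp_mpolyB rE rmorphM rmorphXn /=.
by rewrite comp_mpolyB !comp_mpolyXU -!tnth_nth !ts.
Qed.

(** Under [T], the factor ['X_l ^+ 3] of [g_l] becomes the cube of ['X_l - 'X_ord0], while [g_l]
    becomes [g_l] minus the component at [ord0]. A transposition carries this to any pair. *)
Lemma g_map_cube_diff (i j : 'I_m) : i != j ->
  mdvd (('X_i - 'X_j) ^+ 3) (g_map C n i - g_map C n j).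
Proof.
have cube0 l :
  l != ord0 -> mdvd (('X_l - 'X_ord0) ^+ 3) (g_map C n l - g_map C n ord0).
  move=> /negPf l0; have := g_map_T l; rewrite l0 => <-.
  rewrite /precomp rmorphM rmorphXn /= comp_mpolyXU -tnth_nth.
  by rewrite tnth_T_tuple l0; apply/mdvdMr/mdvd_refl.
move=> ij; pose s : 'S_m := tperm ord0 j.
have si0 : s i != ord0.
  by apply: contra_neq ij => E; apply: (@perm_inj _ s); rewrite E tpermR.
have := mdvd_diff_comp (g_map_perm s) (tnth_perm_tuple s) (cube0 _ si0).
by rewrite tpermK tpermL.
Qed.

Lemma g_map_cube p :
  mdvd (mirror_form C p ^+ 3) (comb (mirror_row C p) (g_map C n)).
Proof.
rewrite /comb sum_mirror_row mirror_formE; case: eqP => [_|/eqP p12].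
  by rewrite !scale0r !subr0; apply/mdvdMr/mdvd_refl.
by rewrite !scale1r; apply: g_map_cube_diff.
Qed.

End Primitive.

(** * Signs of the mirrors, dominance of [g], and the conclusion *)

Lemma vanishes_to_orderN (C : fieldType) n (a p : {mpoly C[ncoord n]}) k :
  vanishes_to_order a p k -> vanishes_to_order (- a) p k.
Proof.
have signed b j q : mdvd ((- b) ^+ j) q -> mdvd (b ^+ j) q.
  by move=> [r ->]; rewrite exprNn mulrA; apply/mdvdMl/mdvd_refl.
move=> [akp nakp]; split; last by move=> /signed.
by apply: signed; rewrite opprK.
Qed.

Lemma restricts_dominantlyN (C : fieldType) n (h : poly_lift C n) a :
  restricts_dominantly h a -> restricts_dominantly h (- a).
Proof.
have evN v : eval_at (- a) v = 0 <-> eval_at a v = 0.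
  by rewrite /eval_at mevalN; split=> [/eqP|->];
    rewrite ?oppr_eq0 ?oppr0 // => /eqP.
move=> [hyp [v av inj]]; split=> [w /evN aw|]; first exact/evN/hyp.
by exists v => [|w /evN]; [exact/evN|exact: inj].
Qed.

Lemma mirrorP (C : numFieldType) n (a : {mpoly C[ncoord n]}) : mirror a ->
  exists2 p : 'I_(ncoord n) * 'I_(ncoord n),
    (p.1 <= p.2)%N & a = mirror_form C p \/ a = - mirror_form C p.
Proof.
case=> [k|k l kl]; first by exists (k, k) => //; left;
  rewrite mirror_formE eqxx scale0r subr0.
have [ltkl|ltlk|/val_inj E] := ltngtP k l; last by rewrite E eqxx in kl.
  by exists (k, l); [apply: ltnW|left; rewrite mirror_formE kl scale1r].
exists (l, k); [exact: ltnW|right].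
by rewrite mirror_formE eq_sym kl scale1r opprB.
Qed.

Lemma mirror_mirror_form (C : numFieldType) n (p :
  'I_(ncoord n) * 'I_(ncoord n)) :
  mirror (mirror_form C p).
Proof.
rewrite mirror_formE; case: eqP => [_|/eqP p12].
  by rewrite scale0r subr0; constructor.
by rewrite scale1r; constructor.
Qed.

(** Cancelling the square of the form in [det_jacobian_comb] and evaluating at [mirror_point], where
    no other mirror vanishes, shows that the Jacobian matrix with row [p.1] replaced by the mirror
    row is invertible there. *)
Lemma g_map_restricts_dominantly (C : numFieldType) n (p :
  'I_(ncoord n) * 'I_(ncoord n)) :
  (2 <= n)%N -> (p.1 <= p.2)%N ->
  restricts_dominantly (g_map C n) (mirror_form C p).
Proof.
move=> hn p12; have [q qE] := g_map_cube C hn p.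
have a_point : eval_at (mirror_form C p) (\col_i mirror_point C p i) = 0.
  rewrite /eval_at (@meval_eq _ _ _ (mirror_point C p)) => [|i];
    last by rewrite mxE.
  by apply/eqP; rewrite mirror_pointP.
split=> [v av|].
  rewrite eval_comb qE /eval_at mevalM rmorphXn /=.
  by move: av; rewrite /eval_at => ->; rewrite expr0n mulr0.
exists (\col_i mirror_point C p i) => // w; rewrite eval_lform => aw.
set M := map_mx _ _ => Mw.
have [u] := det_jacobian_comb p.1 qE; rewrite mirror_row_pivot scale1r.
have [c c0 ->] := det_g_map C hn; have [r -> r0] := mirror_prod_split C p12.
rewrite -/(mirror_form C p) scalerAr => /(mulfI (expf_neq0 2 (mirror_form_neq0
  C p))).
move=> /(congr1 (fun P => eval_at P (\col_i mirror_point C p i))).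
rewrite {1 2}/eval_at mevalD mevalZ mevalM mevalMn mevalM.
move: a_point; rewrite {1}/eval_at => ->; rewrite mul0r addr0.
rewrite -[X in _ = _ * X *+ _]/(eval_at _ _) eval_adj_row -/M -det_row_repl =>
  E.
have detN : \det (row_repl M p.1 (mirror_row C p)) != 0.
  apply: contraTneq r0 => D0; move: E; rewrite D0 mulr0 mul0rn => /eqP.
  rewrite mulf_eq0 (negPf c0) /= (@meval_eq _ _ _ (mirror_point C p)) =>
    [->//|i].
  by rewrite mxE.
have uN : row_repl M p.1 (mirror_row C p) \in unitmx by rewrite unitmxE unitfE.
apply: (can_inj (mulKmx uN)); rewrite mulmx0.
apply/colP => i; rewrite mxE [RHS]mxE.
under eq_bigr do rewrite [row_repl _ _ _ _ _]mxE.
case: eqP => _; first by rewrite -[RHS]aw mxE.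
by have /colP/(_ i) := Mw; rewrite !mxE => E'; rewrite -[RHS]E';
  apply: eq_bigr => l _; rewrite mxE.
Qed.

Lemma proj_eq_scale (C : fieldType) n (h k d : poly_lift C n) (a b : C) :
  (forall i, h i = a *: d i) -> (forall i, k i = b *: d i) -> proj_eq h k.
Proof. by move=> hE kE i j; rewrite !hE !kE -!mul_mpolyC; ring. Qed.

Lemma proj_eq_g_map (C : numFieldType) n (h : poly_lift C n) : (2 <= n)%N ->
    (forall i, h i \is n.+1.-homog) ->
    (forall p : 'I_(ncoord n) * 'I_(ncoord n), (p.1 <= p.2)%N ->
       mdvd (mirror_form C p ^+ 3) (comb (mirror_row C p) h)) ->
  proj_eq h (g_map C n).
Proof.
move=> hn h_homog h_cube.
have nE : n.+1 = (ncoord n).+2 by lia.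
have g_homog := g_map_homog C hn.
rewrite nE in h_homog g_homog.
have [c c0 cE] := det_g_map C hn.
have g_cube (p : 'I_(ncoord n) * 'I_(ncoord n)) (_ :
  (p.1 <= p.2)%N) := g_map_cube C hn p.
have [a aE] := cubes_radial g_homog h_homog c0 cE g_cube h_cube.
have [b bE] := cubes_radial g_homog g_homog c0 cE g_cube g_cube.
exact: proj_eq_scale aE bE.
Qed.

(* restricts_dominantly is not in the informal statement: without it the
   uniqueness part is false for n = 3, 4 and 5. *)
Theorem theorem4p2 (R : realType) (n : nat) (hn : (3 <= n)%N) :
  [/\ rational_map n.+1 (g_map R[i] n),
      equivariant (g_map R[i] n),
      (forall a, mirror a -> doubly_critical (g_map R[i] n) a)
    & (forall a, mirror a -> restricts_dominantly (g_map R[i] n) a)] /\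
  (forall h : poly_lift R[i] n,
      rational_map n.+1 h ->
      equivariant h ->
      (forall a, mirror a -> doubly_critical h a) ->
      (forall a, mirror a -> restricts_dominantly h a) ->
      proj_eq h (g_map R[i] n)).
Proof.
have hn2 : (2 <= n)%N by apply: ltnW.
have [c c0 cE] := det_g_map R[i] hn2.
split; last first.
  move=> h [_ h_homog] _ h_crit h_dom; apply: proj_eq_g_map => // p p12.
  have a_mirror := mirror_mirror_form R[i] p.
  exact: comb_cube (mirror_row_pivot _ p) (h_crit _ a_mirror).1 (h_dom _
    a_mirror).
split.
- split; last exact: g_map_homog.
  (* If all components were zero, so would be the Jacobian determinant, a nonzero multiple of
     [mirror_prod]. *)
  apply/existsP; apply: contraLR c0 => /existsPn g0; rewrite negbK.
  suff : c *: mirror_prod R[i] n = 0.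
    by move/eqP; rewrite scaler_eq0 (negPf (mirror_prod_neq0 _ _)) orbF.
  rewrite -cE (_ : jacobian_mx _ = 0) ?det0 //.
  by apply/matrixP => i j; rewrite !mxE (eqP (negbNE (g0 i))) mderiv0.
- exact: g_map_equivariant.
- move=> a /mirrorP[p p12 aE].
  have crit : doubly_critical (g_map R[i] n) (mirror_form R[i] p).
    by rewrite /doubly_critical cE; apply: mirror_prod_order.
  by case: aE => ->; [|apply: vanishes_to_orderN].
- move=> a /mirrorP[p p12 [] ->]; first exact: g_map_restricts_dominantly.
  exact/restricts_dominantlyN/g_map_restricts_dominantly.
Qed.
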